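(* There exists an absolute constant $\delta > 0$ such that for every finite subset $A$ of $\mathbb{R}^2$ and every linear transformation $\mathscr{L} \in \mathrm{GL}_2(\mathbb{R})$ that has no real eigenvalues, one has \[ |A + \mathscr{L}(A)| \geq 4|A| - O(|A|^{1-\delta}), \] where the implied constant is absolute.
   Context: For $A,B \subseteq \mathbb{R}^2$, $A+B = \{a+b : a\in A, b \in B\}$, and $\mathscr{L}(A) = \{\mathscr{L}(a) : a \in A\}$. The notation $X \geq Y - O(Z)$ means that there is a constant $K>0$ (here independent of $A$ and $\mathscr{L}$) with $X \geq Y - KZ$. *)

(* Defs.v *)
From HB Require Import structures.
From mathcomp Require Import all_boot all_order all_algebra finmap.
From mathcomp Require Import all_classical all_reals all_analysis.
Set Implicit Arguments.
Unset Strict Implicit.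
Unset Printing Implicit Defensive.
Import Order.TTheory GRing.Theory Num.Theory.
Local Open Scope ring_scope.

Definition sumset (V : zmodType) (A B : {fset V}) : {fset V} :=
  [fset (a + b)%R | a in A, b in B]%fset.

(* Points of the plane are row vectors and a matrix [L] acts on the right,
   [a |-> a *m L]; this is the convention of [eigenvalue] in mxalgebra. *)
Definition lin_image (R : realType) (L : 'M[R]_2) (A : {fset 'rV[R]_2}) :
    {fset 'rV[R]_2} :=
  [fset (a *m L)%R | a in A]%fset.

(* Main.v *)
Require Import Defs.
From HB Require Import structures.
From mathcomp Require Import all_boot all_order all_algebra finmap.
From mathcomp Require Import all_classical all_reals all_analysis.
From mathcomp Require Import zify ring lra.
Set Implicit Arguments.
Unset Strict Implicit.
Unset Printing Implicit Defensive.
Import Order.TTheory GRing.Theory Num.Theory.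
Local Open Scope ring_scope.

(** Why the theorem is true.  Write [B] for the image of [A] and [N] for their
    common cardinality; one may assume [|A + B| <= 4N], with [N] large.

    Fix a direction [d], and let [m] and [n] be the numbers of lines parallel to
    [d] that meet [A] and [B].  Peeling off extreme lines shows
    [|A + B| >= (N/m + N/n - 1)(m + n - 1)] ([sumset_lines]).  The main term is
    [N(2 + m/n + n/m) >= 4N] and the loss is of order [N/m + N/n + m + n].
    Since the transformation fixes no direction, [A] is covered by [m] lines in
    one direction and by [n] lines in another, so [N <= mn]
    ([leq_card_lines_mul]); hence [N/m <= n], [N/n <= m] and the loss is
    [O(m + n)].  The same inequality with [|A + B| <= 4N] forces [m <= 6n], so
    the loss is [O(n)] ([few_lines_bound]).  It remains to find one direction in
    which [B] lies on few lines.

    Such a direction exists in every torsion-free group for every set of small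
    doubling ([rich_direction]).  The Plunnecke-Ruzsa inequality, in the form
    due to Petridis, bounds [|3B - 2B|] by [K^5 N] with [K = 4]; so, by Ruzsa's
    covering lemma, the difference set [D = B - B] satisfies [D + D <= Y + D]
    with [|Y| <= r = K^5], an absolute constant.  Two consequences follow.
    - By pigeonhole, a proportion [1/r] of any subset of [B] is sent by doubling
      into one translate of [D].  After [t] doublings, two distinct elements of
      [B] survive as soon as [N > r^t]; their difference [d] has
      [2^i d] in [D + D] for all [i <= t] ([dyadic_difference]).
    - Iterated sums of [D] grow polynomially: the [2t]-fold sum of [D] lies in
      [D] plus the [2t]-fold sum of [Y], and the latter has at most [(2t+1)^r]
      elements ([nsumset_absorb], [leq_card_nsumset]).
    Writing integers in binary, the first [2^(t+1)] multiples of [d] lie in a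
    sum of about [2t] copies of [D].  Adding them to [B] therefore multiplies
    its size by at most [K^3] times a power of [t], whereas every line parallel
    to [d] that meets [B] receives at least [2^(t+1)] points.  With [t] of order
    [log N] this leaves [B] on [O(N^(1 - delta))] lines. *)

Local Notation "A [+] B" := (sumset A B) (at level 50, left associativity).

(** The number of values of [g] on [A]; when [g] is additive, the number of
    parallel lines (fibres of [g]) meeting [A]. *)
Local Notation lines g A := #|` [fset g a | a in A]%fset|.

(** * Sumsets of finite sets *)

Lemma cardfsM (S T : choiceType) (A : {fset S}) (B : {fset T}) :
  #|` (A `*` B)%fset| = (#|` A| * #|` B|)%N.
Proof.
rewrite -(size_allpairs pair); apply: perm_size.
apply: perm_trans (enum_imfset2 _ _) _; first by move=> [x y] [x' y'] _ _ [-> ->].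
exact: perm_refl.
Qed.

Lemma leq_card_fset_inj (S T : choiceType) (A : {fset S}) (B : {fset T}) (f : S -> T) :
  {in A, forall x, f x \in B} -> {in A &, injective f} -> (#|` A| <= #|` B|)%N.
Proof.
move=> fAB finj; rewrite -[X in (X <= _)%N](card_in_imfset imfset_key finj).
by apply/fsubset_leq_card/fsubsetP => _ /imfsetP[x xA ->]; exact: fAB.
Qed.

Section Sumsets.
Variable V : zmodType.
Implicit Types A B C X : {fset V}.

Definition oppset A : {fset V} := [fset (- a)%R | a in A]%fset.

Lemma sumsetP A B x :
  reflect (exists a b, [/\ a \in A, b \in B & x = a + b]) (x \in A [+] B).
Proof.
apply: (iffP (imfset2P _ _ _ _ _)).
  by move=> [a aA [b bB ->]]; exists a, b.
by move=> [a [b [aA bB ->]]]; exists a => //; exists b.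
Qed.

Lemma mem_sumset A B a b : a \in A -> b \in B -> a + b \in A [+] B.
Proof. by move=> aA bB; apply/sumsetP; exists a, b. Qed.

Lemma mem_oppset A x : (x \in oppset A) = (- x \in A).
Proof.
apply/imfsetP/idP => [[a aA ->]|xA]; first by rewrite opprK.
by exists (- x) => //; rewrite opprK.
Qed.

Lemma sumsetC A B : A [+] B = B [+] A.
Proof.
apply/fsetP => x; apply/sumsetP/sumsetP => -[a [b [aA bB ->]]];
  by exists b, a; rewrite addrC.
Qed.

Lemma sumsetA A B C : A [+] (B [+] C) = A [+] B [+] C.
Proof.
apply/fsetP => x; apply/sumsetP/sumsetP.
  move=> [a [_ [aA /sumsetP[b [c [bB cC ->]]] ->]]].
  by exists (a + b), c; rewrite addrA mem_sumset.
move=> [_ [c [/sumsetP[a [b [aA bB ->]]] cC ->]]].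
by exists a, (b + c); rewrite addrA mem_sumset.
Qed.

Lemma sumset0l A : [fset 0]%fset [+] A = A.
Proof.
apply/fsetP => x; apply/sumsetP/idP.
  by move=> [a [b [/fset1P-> bA ->]]]; rewrite add0r.
by move=> xA; exists 0, x; rewrite add0r inE.
Qed.

(** Gives access to rewriting modulo associativity and commutativity. *)
HB.instance Definition _ :=
  Monoid.isComLaw.Build {fset V} [fset 0]%fset (@sumset V) sumsetA sumsetC sumset0l.

Lemma sumsetS A A' B B' :
  (A `<=` A')%fset -> (B `<=` B')%fset -> (A [+] B `<=` A' [+] B')%fset.
Proof.
move=> /fsubsetP sA /fsubsetP sB; apply/fsubsetP => x /sumsetP[a [b [aA bB ->]]].
by rewrite mem_sumset ?sA ?sB.
Qed.

Lemma oppset_sumset A B : oppset (A [+] B) = oppset A [+] oppset B.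
Proof.
apply/fsetP => x; rewrite mem_oppset; apply/sumsetP/sumsetP.
  move=> [a [b [aA bB e]]]; exists (- a), (- b).
  by rewrite !mem_oppset !opprK aA bB -opprD -e opprK.
move=> [a [b]]; rewrite !mem_oppset => -[aA bB ->].
by exists (- a), (- b); rewrite opprD.
Qed.

Lemma leq_card_sumset A B : (#|` A [+] B| <= #|` A| * #|` B|)%N.
Proof.
rewrite -cardfsM.
have -> : A [+] B = [fset (x.1 + x.2)%R | x in (A `*` B)%fset]%fset.
  apply/fsetP => x; apply/sumsetP/imfsetP.
    by move=> [a [b [aA bB ->]]]; exists (a, b); rewrite //= in_fsetM aA.
  by move=> [[a b] /=]; rewrite in_fsetM => /andP[aA bB] ->; exists a, b.
exact: leq_imfset_card.
Qed.

Lemma card_translate A c : #|` A [+] [fset c]%fset| = #|` A|.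
Proof.
have -> : A [+] [fset c]%fset = [fset (a + c)%R | a in A]%fset.
  apply/fsetP => x; apply/sumsetP/imfsetP.
    by move=> [a [b [aA /fset1P-> ->]]]; exists a.
  by move=> [a aA ->]; exists a, c; rewrite inE.
by rewrite card_imfset //; exact: addIr.
Qed.

Lemma sumsetUr A B C : A [+] (B `|` C)%fset = ((A [+] B) `|` (A [+] C))%fset.
Proof.
apply/fsetP => x; rewrite inE; apply/sumsetP/orP.
  move=> [a [b [aA]]]; rewrite inE => /orP[] bB ->; [left|right];
    exact: mem_sumset.
by case=> /sumsetP[a [b [aA bB ->]]]; exists a, b; rewrite inE bB ?orbT.
Qed.

Lemma sumset_eq0 A B : (A [+] B == fset0) = (A == fset0) || (B == fset0).
Proof.
apply/idP/idP.
  case: (fset_0Vmem A) => [->|[a aA]]; first by rewrite eqxx.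
  case: (fset_0Vmem B) => [->|[b bB]]; first by rewrite eqxx orbT.
  by move=> /eqP e; have := mem_sumset aA bB; rewrite e inE.
by case/orP => /eqP->; apply/eqP/fsetP => x; rewrite [in RHS]inE;
  apply/negbTE/negP => /sumsetP[a [b []]]; rewrite ?inE.
Qed.

End Sumsets.

(** * Small doubling: inequalities of Ruzsa, Plunnecke and Petridis *)

Section Doubling.
Variable V : zmodType.
Implicit Types A B C X Y P Q : {fset V}.

(** Fix a representation [v = p - q] of each difference.  The pair
    [(x + p, x + q)] determines [v] as the difference of its entries, hence [p]
    and [q], hence [x]. *)
Lemma ruzsa_triangle X P Q :
  (#|` X| * #|` P [+] oppset Q| <= #|` X [+] P| * #|` X [+] Q|)%N.
Proof.
have [f fP] : {f : V -> V * V & forall v, v \in P [+] oppset Q ->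
    [/\ (f v).1 \in P, (f v).2 \in Q & v = (f v).1 - (f v).2]}.
  apply: (@choice _ _ (fun v pq => v \in P [+] oppset Q ->
    [/\ pq.1 \in P, pq.2 \in Q & v = pq.1 - pq.2])) => v.
  case: (boolP (v \in _)) => [/sumsetP[p [q [pP]]]|]; last by exists (0, 0).
  by rewrite mem_oppset => qQ ->; exists (p, - q); rewrite /= opprK.
rewrite -!cardfsM.
pose g (u : V * V) := (u.1 + (f u.2).1, u.1 + (f u.2).2).
apply: (leq_card_fset_inj (f := g)) => [[x v] /=|[x v] [x' v'] /=].
  rewrite !in_fsetM => /andP[/= xX /fP[pP qQ _]].
  by rewrite !mem_sumset.
rewrite !in_fsetM => /andP[/= _ /fP[_ _ ev]] /andP[/= _ /fP[_ _ ev']].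
move=> [e1 e2].
have evv : v = v'.
  rewrite ev ev' -[LHS]add0r -(subrr x) addrACA -opprD e1 e2.
  by rewrite opprD addrACA subrr add0r.
by move: e1; rewrite evv => /addIr->.
Qed.

(** The choice of [X] minimising [|X + B| / |X|] is the input of Petridis' proof of
    the Plunnecke inequality; ratios are cross-multiplied to stay in [nat]. *)
Lemma min_ratio_subset A B : A != fset0 ->
  exists X, [/\ (X `<=` A)%fset, X != fset0,
    (#|` X [+] B| * #|` A| <= #|` A [+] B| * #|` X|)%N &
    forall Z, (Z `<=` X)%fset -> (#|` X [+] B| * #|` Z| <= #|` Z [+] B| * #|` X|)%N].
Proof.
move=> A0; have AA : A \in fpowerset A by rewrite fpowersetE.
pose F (i : fpowerset A) : rat := #|` val i [+] B|%:R / #|` val i|%:R.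
case: (arg_minP F (P := fun i => val i != fset0) (i0 := [` AA]%fset)) => //= X X0 Xmin.
have XA : (val X `<=` A)%fset by rewrite -fpowersetE fsvalP.
have key Z : (Z `<=` A)%fset -> (#|` val X [+] B| * #|` Z| <= #|` Z [+] B| * #|` val X|)%N.
  move=> ZA; have [->|Z0] := eqVneq Z fset0; first by rewrite cardfs0 muln0.
  have ZP : Z \in fpowerset A by rewrite fpowersetE.
  have := Xmin [` ZP]%fset Z0; rewrite /F /=.
  rewrite ler_pdivrMr ?ltr0n ?cardfs_gt0// mulrAC ler_pdivlMr ?ltr0n ?cardfs_gt0//.
  by rewrite -!natrM ler_nat.
exists (val X); split => //; first exact: key.
by move=> Z ZX; apply: key; exact: fsubset_trans XA.
Qed.

(** Petridis' lemma, by adding the points of [C] one at a time.  Minimality is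
    what ensures that the points of [X] bringing nothing new to [X + C] save a
    proportional number of points of [X + B + C]. *)
Lemma petridis X B :
  (forall Z, (Z `<=` X)%fset -> (#|` X [+] B| * #|` Z| <= #|` Z [+] B| * #|` X|)%N) ->
  forall C, (#|` X [+] B [+] C| * #|` X| <= #|` X [+] B| * #|` X [+] C|)%N.
Proof.
move=> Xmin C; elim/finSet_rect: C => C IH.
case: (fset_0Vmem C) => [->|[c cC]].
  have e0 A : A [+] fset0 = fset0 by apply/eqP; rewrite sumset_eq0 eqxx orbT.
  by rewrite !e0 cardfs0 mul0n.
have {}IH := IH _ (fproperD1 cC); set C' := (C `\ c)%fset in IH.
have EC : C = (C' `|` [fset c])%fset by rewrite fsetUC fsetD1K.
(* The translate of [Z] by [c] gives nothing new in [X + C], and the one of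
   [Z + B] nothing new in [X + B + C]. *)
pose Z := [fset x in X | (x + c)%R \in X [+] C']%fset.
have ZX : (Z `<=` X)%fset by exact: fset_sub.
have hL : (#|` X [+] B [+] C| + #|` Z [+] B| <= #|` X [+] B [+] C'| + #|` X [+] B|)%N.
  rewrite EC sumsetUr -(card_translate (X [+] B) c) -(card_translate (Z [+] B) c).
  rewrite -[leqRHS]cardfsUI leq_add2l; apply/fsubset_leq_card/fsubsetP => y yZ.
  rewrite in_fsetI; apply/andP; split; last first.
    by move: yZ; apply/fsubsetP; rewrite !sumsetS.
  have {yZ} := yZ; rewrite -sumsetA [B [+] _]sumsetC sumsetA.
  rewrite -[X [+] B [+] C']sumsetA [B [+] C']sumsetC sumsetA.
  apply/fsubsetP/sumsetS => //; apply/fsubsetP => _ /sumsetP[z [b [+ /fset1P-> ->]]].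
  by rewrite !inE => /andP[].
have hR : (#|` X [+] C'| + #|` X| <= #|` X [+] C| + #|` Z|)%N.
  rewrite EC sumsetUr -(card_translate X c) -(card_translate Z c).
  rewrite -[leqLHS]cardfsUI leq_add2l; apply/fsubset_leq_card/fsubsetP => y.
  rewrite in_fsetI => /andP[yC /sumsetP[x [_ [xX /fset1P-> ey]]]].
  by rewrite ey mem_sumset ?inE //= xX -ey.
have := Xmin _ ZX; nia.
Qed.

(** Every sum with [B] costs a factor [K] for the same set [X], so the estimate
    can be iterated with [C] itself a multiple sum of [B]. *)
Lemma plunnecke_subset (K : nat) A B : A != fset0 ->
  (#|` A [+] B| <= K * #|` A|)%N ->
  exists X, [/\ (X `<=` A)%fset, X != fset0 &
    forall C, (#|` X [+] C [+] B| <= K * #|` X [+] C|)%N].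
Proof.
move=> A0 AK; have [X [XA X0 XK Xmin]] := min_ratio_subset B A0.
exists X; split => // C.
have := petridis Xmin C; rewrite -sumsetA [B [+] C]sumsetC sumsetA.
have XB : (#|` X [+] B| <= K * #|` X|)%N.
  by move: A0; rewrite -cardfs_gt0; nia.
by move: X0; rewrite -cardfs_gt0; nia.
Qed.

(** The sums [X + B + ... + B] are bounded by iterating the previous lemma, and the
    triangle inequality with pivot [X] turns them into bounds for differences. *)
Lemma plunnecke_ruzsa (K : nat) A B : A != fset0 ->
  (#|` A [+] B| <= K * #|` A|)%N ->
  (#|` (B [+] B [+] B) [+] oppset (B [+] B)| <= K ^ 5 * #|` A|)%N /\
  (#|` (B [+] B) [+] oppset B| <= K ^ 3 * #|` A|)%N.
Proof.
move=> A0 AK; have [X [XA X0 XC]] := plunnecke_subset A0 AK.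
have X1 : (#|` X [+] B| <= K * #|` X|)%N.
  by have := XC [fset 0]%fset; rewrite [X [+] [fset 0]%fset]sumsetC sumset0l.
have X2 : (#|` X [+] (B [+] B)| <= K ^ 2 * #|` X|)%N.
  by rewrite sumsetA; have := XC B; nia.
have X3 : (#|` X [+] (B [+] B [+] B)| <= K ^ 3 * #|` X|)%N.
  by rewrite sumsetA; have := XC (B [+] B); nia.
have XA' := fsubset_leq_card XA; rewrite -cardfs_gt0 in X0.
(* The triangle inequality gives two factors [|X|], one of which cancels. *)
have fin i j p q T : (#|` X| * T <= p * q)%N -> (p <= K ^ i * #|` X|)%N ->
    (q <= K ^ j * #|` X|)%N -> (T <= K ^ (i + j) * #|` A|)%N.
  move=> hT hp hq; apply: leq_trans (leq_mul (leqnn _) XA').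
  rewrite -(leq_pmul2l X0); apply: (leq_trans hT).
  by apply: (leq_trans (leq_mul hp hq)); rewrite expnD; lia.
split; first exact: fin (ruzsa_triangle X _ _) X3 X2.
by apply: fin (ruzsa_triangle X _ _) X2 _; rewrite expn1.
Qed.

(** [Y] is a maximal subset of [S] whose translates [y + B] are disjoint: any
    other [s + B] meets one of them, which puts [s] in [Y + (B - B)]. *)
Lemma ruzsa_covering B S : B != fset0 -> exists Y,
  (S `<=` Y [+] (B [+] oppset B))%fset /\ (#|` Y| * #|` B| <= #|` S [+] B|)%N.
Proof.
move=> /fset0Pn[b0 bB0].
suff [Y [YS SY YB]] : exists Y, [/\ (Y `<=` S)%fset,
    (S `<=` Y [+] (B [+] oppset B))%fset & (#|` Y| * #|` B| <= #|` Y [+] B|)%N].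
  exists Y; split => //; apply: (leq_trans YB); apply: fsubset_leq_card.
  exact: sumsetS.
elim/finSet_rect: S => S IH.
case: (fset_0Vmem S) => [->|[s sS]].
  by exists fset0; rewrite !fsub0set cardfs0.
have [Y [YS SY YB]] := IH _ (fproperD1 sS).
have YS' : (Y `<=` S)%fset by apply: (fsubset_trans YS); exact: fsubD1set.
have [sY|sY] := boolP (s \in Y [+] (B [+] oppset B)).
  by exists Y; split => //; rewrite -(fsetD1K sS) fsubUset SY fsub1set sY.
exists (Y `|` [fset s])%fset; split.
- by rewrite fsubUset fsub1set sS YS'.
- rewrite -(fsetD1K sS) fsubUset fsub1set; apply/andP; split.
    rewrite -{1}[s]addr0 -(subrr b0).
    by rewrite !mem_sumset ?inE ?eqxx ?orbT// mem_oppset opprK.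
  by apply: (fsubset_trans SY); rewrite sumsetS ?fsubsetUl.
rewrite [_ [+] B]sumsetC sumsetUr [B [+] Y]sumsetC.
have sY' : s \notin Y.
  by apply: contra sY => sY; rewrite -[s]addr0 -(subrr b0) !mem_sumset ?mem_oppset ?opprK.
rewrite !cardfsU disjoint_fsetI0 ?fdisjointX1// cardfs0 subn0 cardfs1.
rewrite disjoint_fsetI0 ?cardfs0 ?subn0; last first.
  apply/fdisjointP => _ /sumsetP[y [b [yY bB ->]]].
  apply: contra sY => /sumsetP[b' [_ [bB' /fset1P-> e]]].
  have -> : s = y + (b - b') by rewrite addrA e addrAC subrr add0r.
  by rewrite !mem_sumset// mem_oppset opprK.
by rewrite card_translate mulnDl mul1n leq_add2r.
Qed.
End Doubling.

(** * Sets of small doubling lie on few parallel lines *)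

Section Direction.
Variable V : zmodType.
Implicit Types A B D P S Y : {fset V}.

Definition nsumset n Y : {fset V} := iter n (sumset Y) [fset 0]%fset.

(** The sums over [x] in [l] of [k_x x] with [k_x <= n].  They include all
    [n]-fold sums of elements of [l], and there are only polynomially many of them
    in [n]. *)
Fixpoint box n (l : seq V) : {fset V} :=
  if l is x :: l' then [fset (x *+ nat_of_ord k)%R | k : 'I_n.+1]%fset [+] box n l'
  else [fset 0]%fset.

Lemma leq_card_box n l : (#|` box n l| <= n.+1 ^ size l)%N.
Proof.
elim: l => [|x l IH] /=; first by rewrite cardfs1.
apply: (leq_trans (leq_card_sumset _ _)); rewrite expnS leq_mul//.
apply: (leq_trans (leq_imfset_card _ _ _)).
by rewrite /= -cardE card_ord.
Qed.

Lemma box_widen n l : (box n l `<=` box n.+1 l)%fset.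
Proof.
elim: l => [|x l IH] //=; apply: sumsetS => //.
apply/fsubsetP => _ /imfsetP[k _ ->]; apply/imfsetP.
by exists (widen_ord (leqnSn _) k).
Qed.

Lemma box_add n l y z : y \in l -> z \in box n l -> y + z \in box n.+1 l.
Proof.
elim: l z => // x l IH z; rewrite inE => /orP[/eqP->|yl] /= /sumsetP[u [w]].
  move=> [/imfsetP[k _ ->] wl ->]; rewrite addrA -mulrS mem_sumset//.
    by apply/imfsetP; exists (inord k.+1); rewrite //= inordK// ltnS.
  exact: (fsubsetP (box_widen n l)).
move=> [/imfsetP[k _ ->] wl ->]; rewrite addrCA mem_sumset ?IH//.
by apply/imfsetP; exists (widen_ord (leqnSn _) k).
Qed.

Lemma leq_card_nsumset n Y : (#|` nsumset n Y| <= n.+1 ^ #|` Y|)%N.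
Proof.
apply: leq_trans (leq_card_box n Y); apply/fsubset_leq_card.
elim: n => [|n IH] /=.
  apply/fsubsetP => _ /fset1P->.
  elim: (enum_fset Y) => [|x l IH] /=; first by rewrite inE.
  rewrite -[0]addr0 mem_sumset//; apply/imfsetP; exists ord0 => //.
apply/fsubsetP => _ /sumsetP[y [z [yY zn ->]]].
by apply: box_add => //; exact: (fsubsetP IH).
Qed.

Lemma pigeonhole_fset S Y (r : V -> V -> bool) :
  (forall s, s \in S -> exists2 y, y \in Y & r y s) ->
  exists y, (#|` S| <= #|` Y| * #|` [fset s in S | r y s]%fset|)%N.
Proof.
elim/finSet_rect: Y S => Y IH S hS.
case: (fset_0Vmem Y) => [Y0|[y0 y0Y]].
  exists 0; case: (fset_0Vmem S) => [->|[s /hS[y]]]; first by rewrite cardfs0.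
  by rewrite Y0.
pose S1 := [fset s in S | r y0 s]%fset.
have [|y hy] := IH _ (fproperD1 y0Y) (S `\` S1)%fset.
  move=> s; rewrite in_fsetD => /andP[sS1 sS]; have [y yY rys] := hS _ sS.
  exists y => //; rewrite in_fsetD1 yY andbT; apply: contraNneq sS1 => yy0.
  by rewrite !inE sS /= -yy0.
have hS1 : (#|` S| = #|` S1| + #|` (S `\` S1)%fset|)%N.
  by rewrite -(cardfsID S1 S) (fsetIidPr _)//; exact: fset_sub.
have hy' : (#|` [fset s in (S `\` S1)%fset | r y s]%fset| <= #|` [fset s in S | r y s]%fset|)%N.
  apply/fsubset_leq_card/fsubsetP => s; rewrite !inE /=.
  by case/andP => /andP[_ ->] ->.
have YE : (#|` Y| = 1 + #|` (Y `\ y0)%fset|)%N by rewrite (cardfsD1 y0) y0Y.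
rewrite hS1 YE.
have [h|/ltnW h] := leqP #|` S1| #|` [fset s in S | r y s]%fset|; [exists y|exists y0];
  rewrite mulnDl mul1n leq_add// (leq_trans hy)// leq_mul2l.
  by rewrite hy' orbT.
by rewrite (leq_trans hy' h) orbT.
Qed.

(** If [2^i s] stays in one translate [y + D] then [2^(i+1) s] lies in
    [2y + D + D], that is in one of the translates [2y + z + D] with [z] in [Y];
    keeping the most popular [z] costs a factor [|Y|]. *)
Lemma dyadic_subset B Y t : let D := B [+] oppset B in
  B != fset0 -> (D [+] D `<=` Y [+] D)%fset ->
  exists S, [/\ (S `<=` B)%fset, (#|` B| <= #|` Y| ^ t * #|` S|)%N &
    forall i, (i <= t)%N -> exists y, forall s, s \in S -> s *+ 2 ^ i - y \in D].
Proof.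
move=> D /fset0Pn[b0 bB0] DY; elim: t => [|t [S [SB cS hS]]].
  exists B; rewrite mul1n; split => // i; rewrite leqn0 => /eqP->; exists b0.
  by move=> s sB; rewrite mem_sumset// mem_oppset opprK.
have [y hy] := hS t (leqnn t).
have [|z hz] := @pigeonhole_fset S Y (fun z s => s *+ 2 ^ t.+1 - y *+ 2 - z \in D).
  move=> s sS; rewrite expnSr mulrnA -mulrnBl mulr2n.
  have /(fsubsetP DY)/sumsetP[z [e [zY eD ->]]] :
    s *+ 2 ^ t - y + (s *+ 2 ^ t - y) \in D [+] D by rewrite mem_sumset ?hy.
  by exists z => //; rewrite addrC addrA addNr add0r.
exists [fset s in S | s *+ 2 ^ t.+1 - y *+ 2 - z \in D]%fset; split.
- by apply: fsubset_trans SB; exact: fset_sub.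
- by rewrite expnSr -mulnA (leq_trans cS)// leq_mul2l hz orbT.
move=> i; rewrite leq_eqVlt ltnS => /orP[/eqP->|/hS[w hw]].
  by exists (y *+ 2 + z) => s; rewrite !inE /= => /andP[_]; rewrite [- (_ + z)]opprD addrA.
by exists w => s; rewrite !inE => /andP[/hw].
Qed.

Lemma mem_oppset_diff B x : (- x \in B [+] oppset B) = (x \in B [+] oppset B).
Proof.
suff h y : y \in B [+] oppset B -> - y \in B [+] oppset B.
  by apply/idP/idP => /h //; rewrite opprK.
move=> /sumsetP[a [b [aB]]]; rewrite mem_oppset => bB ->.
by rewrite opprD addrC mem_sumset// mem_oppset opprK.
Qed.

(** As soon as the set of the previous lemma has two elements, their difference no
    longer sees the translations. *)
Lemma dyadic_difference B Y t : let D := B [+] oppset B in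
  (D [+] D `<=` Y [+] D)%fset -> (#|` Y| ^ t < #|` B|)%N ->
  exists2 d, d != 0 & forall i, (i <= t)%N -> d *+ 2 ^ i \in D [+] D.
Proof.
move=> D DY Bt.
have B0 : B != fset0 by rewrite -cardfs_gt0 (leq_ltn_trans _ Bt).
have [S [SB cS hS]] := dyadic_subset t B0 DY.
have [a [b [aS bS ab]]] : exists a b, [/\ a \in S, b \in S & a != b].
  have : (1 < #|` S|)%N by nia.
  case: (fset_0Vmem S) => [->|[a aS]]; first by rewrite cardfs0.
  rewrite (cardfsD1 a) aS ltnS cardfs_gt0 => /fset0Pn[b].
  by rewrite in_fsetD1 eq_sym => /andP[ab bS]; exists a, b.
exists (a - b); first by rewrite subr_eq0.
move=> i /hS[y hy]; have -> : (a - b) *+ 2 ^ i = (a *+ 2 ^ i - y) + - (b *+ 2 ^ i - y).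
  by rewrite opprB addrA subrK mulrnBl.
by rewrite mem_sumset ?hy// mem_oppset_diff hy.
Qed.

(** Expand [j] in base two; the assumption [0 \in S] takes care of the digits
    that vanish. *)
Lemma binary_multiples S d t j : 0 \in S ->
  (forall i, (i < t)%N -> d *+ 2 ^ i \in S) -> (j < 2 ^ t)%N ->
  d *+ j \in nsumset t S.
Proof.
move=> S0; elim: t j => [|t IH] j hd jt.
  by move: jt; rewrite ltnS leqn0 => /eqP->; rewrite mulr0n inE.
have {}IH k : (k < 2 ^ t)%N -> d *+ k \in nsumset t S.
  by apply: IH => i it; apply: hd; exact: ltnW.
have [h|h] := ltnP j (2 ^ t); first by rewrite -[_ *+ _]add0r mem_sumset ?IH.
rewrite -(subnKC h) mulrnDr mem_sumset ?hd// IH//.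
by rewrite expnS in jt; lia.
Qed.

(** The inclusion [D + D <= Y + D] trades each copy of [D] beyond the first for
    one of [Y]; it is what makes multiple sums of [D] grow polynomially. *)
Lemma nsumset_absorb D Y t : (D [+] D `<=` Y [+] D)%fset ->
  (D [+] nsumset t (D [+] D) `<=` D [+] nsumset t.*2 Y)%fset.
Proof.
move=> DY; elim: t => [|t IH] //; rewrite doubleS /=.
set W := nsumset _ Y in IH *; set U := nsumset _ _ in IH *.
have -> : D [+] (D [+] D [+] U) = D [+] D [+] (D [+] U) by rewrite !sumsetA.
apply: (fsubset_trans (sumsetS (fsubset_refl _) IH)).
have -> : D [+] D [+] (D [+] W) = D [+] D [+] D [+] W by rewrite !sumsetA.
have h : (D [+] D [+] D `<=` D [+] (Y [+] Y))%fset.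
  apply: (fsubset_trans (sumsetS DY (fsubset_refl _))).
  have -> : Y [+] D [+] D = Y [+] (D [+] D) by rewrite sumsetA.
  apply: (fsubset_trans (sumsetS (fsubset_refl _) DY)).
  by rewrite sumsetA sumsetC.
have -> : D [+] (Y [+] (Y [+] W)) = D [+] (Y [+] Y) [+] W by rewrite !sumsetA.
exact: sumsetS h (fsubset_refl _).
Qed.

(** Translating by [P] stays inside the fibres of [f], so each fibre that meets [A]
    contains at least [|P|] points of [A + P]. *)
Lemma leq_card_fibres (T : choiceType) (f : V -> T) A P :
  (forall v p, p \in P -> f (v + p) = f v) ->
  (#|` [fset f a | a in A]%fset| * #|` P| <= #|` A [+] P|)%N.
Proof.
move=> fP; rewrite -cardfsM.
have [s sP] : {s : T -> V & forall x, x \in [fset f a | a in A]%fset ->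
    s x \in A /\ f (s x) = x}.
  apply: (@choice _ _ (fun x v => x \in [fset f a | a in A]%fset ->
    v \in A /\ f v = x)) => x.
  by case: (boolP (x \in _)) => [/imfsetP[a aA ->]|_]; [exists a|exists 0].
apply: (leq_card_fset_inj (f := fun u => s u.1 + u.2)) => [[x p]|[x p] [x' p'] /=].
  by rewrite in_fsetM => /andP[/= /sP[sA _] pP]; rewrite mem_sumset.
rewrite !in_fsetM => /andP[/= /sP[_ fx] pP] /andP[/= /sP[_ fx'] pP'] e.
have xx : x = x' by rewrite -fx -(fP _ _ pP) e fP.
by move: e; rewrite xx => /addrI->.
Qed.

(** [f] stands for the projection along [d], and the number of its values on
    [B] for the number of lines parallel to [d] that meet [B].  It is counted
    through the sumset of [B] with the progression [{j d : j < 2^(t+1)}]. *)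
Lemma rich_direction (K t : nat) A B :
  (forall (v : V) n, v *+ n = 0 -> v = 0 \/ n = 0%N) ->
  #|` A| = #|` B| -> (#|` A [+] B| <= K * #|` A|)%N -> ((K ^ 5) ^ t < #|` B|)%N ->
  exists2 d : V, d != 0 & forall (T : choiceType) (f : V -> T),
    (forall v j, f (v + d *+ j) = f v) ->
    (#|` [fset f b | b in B]%fset| * 2 ^ t.+1 <= K ^ 3 * #|` B| * t.+1.*2.+1 ^ (K ^ 5))%N.
Proof.
move=> tf AB ABK Bt.
have B0 : B != fset0 by rewrite -cardfs_gt0 (leq_ltn_trans _ Bt).
have A0 : A != fset0 by rewrite -cardfs_gt0 AB cardfs_gt0.
have [h5 h3] := plunnecke_ruzsa A0 ABK; rewrite AB in h5 h3.
pose D := B [+] oppset B.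
have [Y [DY cY]] := ruzsa_covering (D [+] D) B0.
(* [D + D + B] is [3B - 2B]. *)
have {}cY : (#|` Y| <= K ^ 5)%N.
  rewrite -cardfs_gt0 in B0; rewrite -(leq_pmul2r B0); apply: (leq_trans cY).
  suff -> : D [+] D [+] B = B [+] B [+] B [+] oppset (B [+] B) by [].
  by rewrite oppset_sumset [LHS](AC (2*2*1) ((1*3*5)*(2*4))).
have [|d d0 hd] := dyadic_difference (t := t) DY.
  by apply: leq_ltn_trans Bt; case: (t) => // t'; rewrite leq_exp2r.
exists d => // T f fd.
pose P := [fset (d *+ nat_of_ord j)%R | j : 'I_(2 ^ t.+1)]%fset.
have cP : #|` P| = (2 ^ t.+1)%N.
  rewrite card_in_imfset /= -?cardE ?card_ord// => j j' _ _.
  move=> e; apply/val_inj => /=.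
  wlog jj : j j' e / (j <= j')%N.
    by case/orP: (leq_total j j') => jj h; [exact: h|symmetry; exact: h].
  have : d *+ (j' - j) = 0 by rewrite mulrnBr// e subrr.
  by case/tf => [/eqP|]; [rewrite (negbTE d0)|lia].
have D0 : 0 \in D.
  by have /fset0Pn[b bB] := B0; rewrite -(subrr b) mem_sumset// mem_oppset opprK.
have hP : (P `<=` nsumset t.+1 (D [+] D))%fset.
  apply/fsubsetP => _ /imfsetP[j _ ->]; apply: binary_multiples => //.
  by rewrite -[0]addr0 mem_sumset.
rewrite -cP; apply: (leq_trans (leq_card_fibres _ _)) => [v p /imfsetP[j _ ->]//|].
(* [0 \in D] lets the progression be viewed inside [D] plus a sum of [D + D]. *)
have : (B [+] P `<=` B [+] D [+] nsumset t.+1.*2 Y)%fset.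
  rewrite -sumsetA; apply: sumsetS => //.
  apply: fsubset_trans (nsumset_absorb t.+1 DY).
  rewrite -[P]sumset0l; apply: sumsetS => //; by rewrite fsub1set.
move/fsubset_leq_card => h; apply: (leq_trans h).
apply: (leq_trans (leq_card_sumset _ _)); apply: leq_mul.
  by rewrite /D sumsetA.
apply: (leq_trans (leq_card_nsumset _ _)).
by rewrite leq_pexp2l.
Qed.
End Direction.

(** * Sumsets of sets covered by parallel lines *)

Section Lines.
Variables (V : zmodType) (R : realFieldType).
Implicit Types (A B : {fset V}) (f g h : V -> R).

Lemma fset_max f A : A != fset0 ->
  exists2 a, a \in A & forall x, x \in A -> f x <= f a.
Proof.
move=> /fset0Pn[a0 a0A].
case: (@arg_maxP _ _ _ [` a0A]%fset xpredT (fun i => f (val i))) => // a _ amax.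
by exists (val a) => [|x xA]; [exact: fsvalP|exact: amax [` xA]%fset isT].
Qed.

(** The order given by [h] makes [A + min B] and [max A + B] overlap in a
    single point ([b] minimises [h] on [B], being a maximum of its opposite). *)
Lemma leq_card_sumset_line h A B :
  {morph h : x y / x + y} -> {in A &, injective h} -> A != fset0 -> B != fset0 ->
  (#|` A| + #|` B| <= #|` A [+] B|.+1)%N.
Proof.
move=> hD hA A0 B0.
have [a aA amax] := fset_max h A0.
have [b bB bmin] := fset_max (fun x => - h x) B0.
rewrite -(card_translate A b) -(card_translate B a) -cardfsUI -addn1 leq_add//.
  apply/fsubset_leq_card; rewrite fsubUset sumsetS ?fsub1set//=.
  by rewrite sumsetC sumsetS ?fsub1set.
rewrite -(cardfs1 (a + b)); apply/fsubset_leq_card/fsubsetP => x.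
rewrite in_fsetI => /andP[/sumsetP[a' [_ [a'A /fset1P-> ->]]]].
move=> /sumsetP[b' [_ [b'B /fset1P-> e]]].
have /(congr1 h) := e; rewrite !hD => eh.
suff -> : a' = a by rewrite inE.
apply: hA => //; apply/eqP; rewrite eq_le amax//=.
by have := bmin _ b'B; lra.
Qed.

Lemma lines_gt0 g A : (0 < lines g A)%N = (A != fset0).
Proof.
rewrite cardfs_gt0; apply/idP/idP; last first.
  by move=> /fset0Pn[a aA]; apply/fset0Pn; exists (g a); apply/imfsetP; exists a.
by apply: contra_neq => ->; apply/fsetP => x; rewrite in_fset0; apply/imfsetP => -[].
Qed.

Lemma leq_lines_card g A : (lines g A <= #|` A|)%N.
Proof. exact: leq_imfset_card. Qed.

(** [A1] is the part of [A] on its extreme line, where [g] is maximal. *)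
Lemma peel_line g A : A != fset0 -> exists A1, [/\ A1 != fset0, (A1 `<=` A)%fset,
  lines g A = (lines g (A `\` A1)%fset).+1 &
  exists x, (forall a, a \in A1 -> g a = x) /\ forall a, a \in (A `\` A1)%fset -> g a < x].
Proof.
move=> A0; have [a aA amax] := fset_max g A0.
pose A1 := [fset x in A | g x == g a]%fset.
have gA' x : x \in (A `\` A1)%fset -> g x < g a.
  rewrite !inE => /andP[+ xA]; rewrite xA /= => ne.
  by rewrite lt_neqAle ne amax.
exists A1; split.
- by apply/fset0Pn; exists a; rewrite !inE aA /=.
- exact: fset_sub.
- have -> : [fset g x | x in A]%fset = (g a |` [fset g x | x in (A `\` A1)%fset])%fset.
    apply/fsetP => y; rewrite in_fset1U; apply/imfsetP/orP.
      move=> [x xA ->]; have [e|e] := eqVneq (g x) (g a); [by left|right].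
      by apply/imfsetP; exists x => //; rewrite !inE xA /= e.
    by case=> [/eqP->|/imfsetP[x /= + ->]]; [exists a|rewrite inE => /andP[_ xA]; exists x].
  rewrite cardfsU1; case: imfsetP => // -[x /= xA' e].
  by have := gA' _ xA'; rewrite -e ltxx.
- exists (g a); split => // x; by rewrite !inE => /andP[_ /eqP].
Qed.

(** Induction on the number of lines.  The extreme lines [A1] of [A] and [B1] of
    [B] contribute [|A1| + |B1| - 1] sums that occur neither in [A' + B] nor in
    [A + B'], where [A'] and [B'] are the remaining parts.  With [m'] and [n'] the
    numbers of lines of [A'] and [B'], the average of the two resulting bounds with
    weights [m'] and [n'] is exactly the claim (one line each being direct).
    This amounts to averaging over all monotone lattice paths through the grid of
    pairs of lines.

    The function [h] is a coordinate along the lines. *)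
Lemma sumset_lines g h A B :
  {morph g : x y / x + y} -> {morph h : x y / x + y} ->
  (forall v w, g v = g w -> h v = h w -> v = w) ->
  A != fset0 -> B != fset0 ->
  (#|` A|%:R / (lines g A)%:R + #|` B|%:R / (lines g B)%:R - 1) *
    ((lines g A)%:R + (lines g B)%:R - 1) <= #|` A [+] B|%:R :> R.
Proof.
move=> gD hD ghI; have [k] := ubnP (lines g A + lines g B)%N.
elim: k A B => // k IH A B; rewrite ltnS => lek A0 B0.
have [A1 [A10 A1A mE [x [gA1 gA']]]] := peel_line g A0.
have [B1 [B10 B1B nE [y [gB1 gB']]]] := peel_line g B0.
set A' := (A `\` A1)%fset in mE gA'; set B' := (B `\` B1)%fset in nE gB'.
have cA : (#|` A| = #|` A1| + #|` A'|)%N by rewrite -(cardfsID A1 A) (fsetIidPr _).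
have cB : (#|` B| = #|` B1| + #|` B'|)%N by rewrite -(cardfsID B1 B) (fsetIidPr _).
have gA z : z \in A -> g z <= x.
  move=> zA; have [/gA1->//|zA1] := boolP (z \in A1).
  by apply/ltW/gA'; rewrite in_fsetD zA1.
have gB z : z \in B -> g z <= y.
  move=> zB; have [/gB1->//|zB1] := boolP (z \in B1).
  by apply/ltW/gB'; rewrite in_fsetD zB1.
have top : (#|` A1| + #|` B1| <= #|` A1 [+] B1|.+1)%N.
  apply: (leq_card_sumset_line hD) => // v w vA wA; apply: ghI.
  by rewrite !gA1.
have split2 C E : (C `<=` A)%fset -> (E `<=` B)%fset ->
    (forall c e, c \in C -> e \in E -> g c + g e < x + y) ->
    (#|` A1| + #|` B1| + #|` C [+] E| <= #|` A [+] B|.+1)%N.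
  move=> CA EB lt; apply: leq_trans (leq_add top (leqnn _)) _.
  rewrite addSn ltnS -cardfsUI disjoint_fsetI0 ?cardfs0 ?addn0.
    by apply/fsubset_leq_card; rewrite fsubUset !sumsetS.
  apply/fdisjointP => _ /sumsetP[a [b [aA1 bB1 ->]]].
  apply/negP => /sumsetP[c [e [cC eE /(congr1 g)]]]; rewrite !gD gA1// gB1//.
  by have := lt _ _ cC eE; lra.
have T1 : (#|` A1| + #|` B1| + #|` A' [+] B| <= #|` A [+] B|.+1)%N.
  apply: split2 => //; first exact: fsubsetDl.
  by move=> c e /gA' + /gB; lra.
have T2 : (#|` A1| + #|` B1| + #|` A [+] B'| <= #|` A [+] B|.+1)%N.
  apply: split2 => //; first exact: fsubsetDl.
  by move=> c e /gA + /gB'; lra.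
move: mE nE; move: (lines_gt0 g A') (lines_gt0 g B').
set m' := lines g A'; set n' := lines g B' => m'0 n'0 mE nE.
(* The induction hypothesis multiplied by [m'], so that it still makes sense,
   and holds trivially, when [A'] is empty. *)
have IH1 : m'%:R * #|` A' [+] B|%:R >= (m' + n')%:R * #|` A'|%:R +
   (m' + n')%:R * m'%:R * (#|` B|%:R / n'.+1%:R) - (m' + n')%:R * m'%:R :> R.
  have [A'0|A'0] := eqVneq A' fset0.
    have -> : m' = 0%N by apply/eqP; rewrite -leqn0 leqNgt m'0 A'0 eqxx.
    by rewrite A'0 cardfs0 !(mulr0, mul0r) addr0 subr0.
  have := IH A' B _ A'0 B0; rewrite nE -/m' addnS => /(_ _) H.
  have {}H := H ltac:(by move: lek; rewrite mE nE addSn addnS).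
  have m0 : 0 < m'%:R :> R by rewrite ltr0n m'0.
  have := ler_wpM2l (ltW m0) H; rewrite natrD -!natr1.
  set b := _ / (n'%:R + 1); set T := _%:R => {}H.
  have e : m'%:R * (#|` A'|%:R / m'%:R) = #|` A'|%:R :> R by rewrite mulrC divfK// gt_eqF.
  move: e H; set a := #|` A'|%:R / _ => e H; rewrite -e.
  by apply: le_trans H; rewrite le_eqVlt; apply/orP; left; apply/eqP; ring.
have IH2 : n'%:R * #|` A [+] B'|%:R >= (m' + n')%:R * #|` B'|%:R +
   (m' + n')%:R * n'%:R * (#|` A|%:R / m'.+1%:R) - (m' + n')%:R * n'%:R :> R.
  have [B'0|B'0] := eqVneq B' fset0.
    have -> : n' = 0%N by apply/eqP; rewrite -leqn0 leqNgt n'0 B'0 eqxx.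
    by rewrite B'0 cardfs0 !(mulr0, mul0r) addr0 subr0.
  have := IH A B' _ A0 B'0; rewrite mE -/n' addSn => /(_ _) H.
  have {}H := H ltac:(by move: lek; rewrite mE nE addSn addnS).
  have n0 : 0 < n'%:R :> R by rewrite ltr0n n'0.
  have := ler_wpM2l (ltW n0) H; rewrite natrD -!natr1.
  set a := _ / (m'%:R + 1); set T := _%:R => {}H.
  have e : n'%:R * (#|` B'|%:R / n'%:R) = #|` B'|%:R :> R by rewrite mulrC divfK// gt_eqF.
  move: e H; set b := #|` B'|%:R / _ => e H; rewrite -e.
  by apply: le_trans H; rewrite le_eqVlt; apply/orP; left; apply/eqP; ring.
rewrite mE nE.
have eA : #|` A|%:R = (#|` A|%:R / m'.+1%:R) * m'.+1%:R :> R by rewrite divfK// pnatr_eq0.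
have eB : #|` B|%:R = (#|` B|%:R / n'.+1%:R) * n'.+1%:R :> R by rewrite divfK// pnatr_eq0.
move: IH1 IH2 eA eB; set a := _ / m'.+1%:R; set b := _ / n'.+1%:R.
have {}T1 : #|` A1|%:R + #|` B1|%:R + #|` A' [+] B|%:R <= #|` A [+] B|%:R + 1 :> R.
  by rewrite -!natrD natr1 ler_nat.
have {}T2 : #|` A1|%:R + #|` B1|%:R + #|` A [+] B'|%:R <= #|` A [+] B|%:R + 1 :> R.
  by rewrite -!natrD natr1 ler_nat.
move: T1 T2; rewrite cA cB -!natr1 !natrD.
have [s0|s0] := posnP (m' + n')%N.
  have [m0 n0] : m' = 0%N /\ n' = 0%N by lia.
  have A'0 : A' = fset0 by apply/eqP/negPn; rewrite -m'0 m0.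
  have B'0 : B' = fset0 by apply/eqP/negPn; rewrite -n'0 n0.
  rewrite m0 n0 A'0 B'0 cardfs0 => T1 _ _ _ eA eB.
  by have : 0 <= #|` fset0 [+] B|%:R :> R by []; lra.
have sR : 0 < m'%:R + n'%:R :> R by rewrite -natrD ltr0n.
have mR : 0 <= m'%:R :> R by []. have nR : 0 <= n'%:R :> R by [].
move: #|` A1|%:R #|` B1|%:R #|` A'|%:R #|` B'|%:R #|` A' [+] B|%:R #|` A [+] B'|%:R #|` A [+] B|%:R
  => A1r B1r A'r B'r T1r T2r Tr T1 T2 I1 I2 eA eB.
rewrite -(ler_pM2l sR).
have h1 := ler_wpM2l mR T1. have h2 := ler_wpM2l nR T2.
have := congr1 ( *%R (m'%:R + n'%:R)) eA; have := congr1 ( *%R (m'%:R + n'%:R)) eB.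
lra.
Qed.
End Lines.

(** With [a = N/m] and [b = N/n], the bound of [sumset_lines] is
    [(a + b - 1)(m + n - 1)].  Here [am + bn = 2N] and [an + bm >= 2N] by the
    inequality of arithmetic and geometric means, while [N <= mn] gives
    [a <= n] and [b <= m]; so at most [2(m + n)] is lost.  Finally [m <= 6n], since
    otherwise [b(m + n - 1)] would exceed what [|A + B| <= 4N] allows. *)
Lemma few_lines_bound (V : zmodType) (R : realFieldType) (g h : V -> R)
    (A B : {fset V}) :
  {morph g : x y / x + y} -> {morph h : x y / x + y} ->
  (forall v w, g v = g w -> h v = h w -> v = w) ->
  A != fset0 -> #|` B| = #|` A| -> (#|` A| <= lines g A * lines g B)%N ->
  (#|` A [+] B| <= 4 * #|` A|)%N ->
  (4 * #|` A| <= #|` A [+] B| + 14 * lines g B)%N.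
Proof.
move=> gD hD gh A0 BA Nmn T4.
have B0 : B != fset0 by rewrite -cardfs_gt0 BA cardfs_gt0.
have := sumset_lines gD hD gh A0 B0.
have mN := leq_lines_card g A. have nN := leq_lines_card g B.
have m0 := lines_gt0 g A. have n0 := lines_gt0 g B.
rewrite A0 in m0; rewrite B0 in n0; rewrite BA in nN *.
set m := lines g A in m0 mN Nmn *; set n := lines g B in n0 nN Nmn *.
set N := #|` A| in mN nN Nmn T4 *; set T := #|` A [+] B| in T4 * => H.
rewrite -(ler_nat R) [(_ + _)%:R]natrD !natrM.
rewrite -(ler_nat R) natrM in T4; rewrite -(ler_nat R) in mN; rewrite -(ler_nat R) in nN.
rewrite -(ler_nat R) natrM in Nmn.
have mR : 1 <= m%:R :> R by rewrite ler1n.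
have nR : 1 <= n%:R :> R by rewrite ler1n.
move: m%:R n%:R N%:R T%:R mR nR mN nN Nmn T4 H => {m m0 n n0 N T} m n N T.
move=> m1 n1 mN nN Nmn T4 H.
have mp : 0 < m by lra. have np : 0 < n by lra. have Np : 0 < N by lra.
pose a := N / m; pose b := N / n.
have am : a * m = N by rewrite /a divfK// gt_eqF.
have bn : b * n = N by rewrite /b divfK// gt_eqF.
rewrite -/a -/b in H.
have an : a <= n by rewrite /a ler_pdivrMr// mulrC.
have bm : b <= m by rewrite /b ler_pdivrMr// mulrC.
have ap : 0 < a by rewrite divr_gt0.
have bp : 0 < b by rewrite divr_gt0.
have abN : 2 * N <= a * n + b * m.
  have : 0 <= (m - n) ^+ 2 * (N / (m * n)).
    by rewrite mulr_ge0 ?sqr_ge0// divr_ge0 ?mulr_ge0//; lra.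
  have -> : (m - n) ^+ 2 * (N / (m * n)) = a * n + b * m - 2 * N.
    by rewrite /a /b; field; rewrite !gt_eqF.
  by rewrite subr_ge0.
have m6 : m <= 6 * n.
  have : b * (m + n - 1) <= 6 * N.
    have : 0 <= a * (m + n - 1) by apply: mulr_ge0; lra.
    lra.
  move=> le6; have : b * (m + n - 1) <= b * (6 * n) by lra.
  by rewrite ler_pM2l//; lra.
lra.
Qed.

(** [(u+1)^r] is at most the product of [r] consecutive integers
    [(u+1)...(u+r)], which is [r!] times a binomial coefficient, itself at most
    [2^(u+r)]. *)
Lemma succn_expn_bound r : exists C, forall u, ((4 * u + 3) ^ r <= C * 2 ^ u)%N.
Proof.
have bin_le n m : ('C(n, m) <= 2 ^ n)%N.
  elim: n m => [|n IH] [|m] //; first by rewrite bin0 expn_gt0.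
  by rewrite binS expnS mul2n -addnn leq_add.
have ffact_ge u : (u.+1 ^ r <= (u + r) ^_ r)%N.
  elim: r => // r IH; rewrite addnS ffactSS expnS leq_mul// ltnS; lia.
exists (8 ^ r * r`!)%N => u.
apply: (@leq_trans ((4 * u.+1) ^ r)).
  by case: (r) => // r'; rewrite leq_exp2r//; lia.
have -> : (8 ^ r * r`! * 2 ^ u = 4 ^ r * (2 ^ (u + r) * r`!))%N.
  by rewrite (_ : 8 = 4 * 2)%N// expnMn expnD; lia.
rewrite expnMn leq_mul2l; apply/orP; right.
by rewrite (leq_trans (ffact_ge u))// -bin_ffact leq_mul2r bin_le orbT.
Qed.

(** * The plane *)

Section Plane.
Variable R : realType.
Local Notation plane := 'rV[R]_2.
Implicit Types (A : {fset plane}) (L : 'M[R]_2) (d v w : plane).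

(** For [d != 0], its fibres are the lines parallel to [d]. *)
Definition cross d v : R := v 0 0 * d 0 1 - v 0 1 * d 0 0.
Definition dot d v : R := v 0 0 * d 0 0 + v 0 1 * d 0 1.

Lemma plane_eqP v w : v 0 0 = w 0 0 -> v 0 1 = w 0 1 -> v = w.
Proof.
move=> e0 e1; apply/rowP => i; case: i => -[|[|//]] i.
  by rewrite (_ : Ordinal i = 0) //; exact: val_inj.
by rewrite (_ : Ordinal i = 1) //; exact: val_inj.
Qed.

Lemma crossD d : {morph cross d : x y / x + y}.
Proof. by move=> x y; rewrite /cross !mxE; ring. Qed.

Lemma dotD d : {morph dot d : x y / x + y}.
Proof. by move=> x y; rewrite /dot !mxE; ring. Qed.

Lemma dot_self_gt0 d : d != 0 -> 0 < d 0 0 ^+ 2 + d 0 1 ^+ 2.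
Proof.
move=> d0; rewrite lt_neqAle addr_ge0 ?sqr_ge0// andbT eq_sym.
rewrite paddr_eq0 ?sqr_ge0// !sqrf_eq0; apply: contra d0 => /andP[/eqP e0 /eqP e1].
by apply/eqP/plane_eqP; rewrite ?e0 ?e1 mxE.
Qed.

Lemma cross_dot_inj d v w : d != 0 ->
  cross d v = cross d w -> dot d v = dot d w -> v = w.
Proof.
move=> /dot_self_gt0 dp; rewrite /cross /dot => ec ed.
by apply: plane_eqP; apply: (mulIf (lt0r_neq0 dp)); rewrite !expr2;
  [have := congr1 ( *%R (d 0 1)) ec; have := congr1 ( *%R (d 0 0)) ed
  |have := congr1 ( *%R (d 0 0)) ec; have := congr1 ( *%R (d 0 1)) ed]; lra.
Qed.

Lemma cross_eq0 d v : d != 0 -> cross d v = 0 -> exists c, v = c *: d.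
Proof.
move=> d0 cv; have dp := dot_self_gt0 d0.
exists (dot d v / (d 0 0 ^+ 2 + d 0 1 ^+ 2)).
apply: (cross_dot_inj d0).
  by rewrite cv /cross !mxE; ring.
by rewrite {2}/dot !mxE; field; rewrite gt_eqF.
Qed.

(** If [a] and [b] are on one line parallel to [d], and so are their images, then
    [a - b] and its image are both multiples of [d]: an eigenvector, unless
    [a = b]. *)
Lemma leq_card_lines_mul L A d : d != 0 -> (forall a : R, ~~ eigenvalue L a) ->
  (#|` A| <= lines (cross d) A * lines (cross d) (lin_image L A))%N.
Proof.
move=> d0 noeig; rewrite -cardfsM.
apply: (leq_card_fset_inj (f := fun a => (cross d a, cross d (a *m L)))).
  move=> a aA; rewrite in_fsetM /=; apply/andP; split; apply/imfsetP; first by exists a.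
  by exists (a *m L) => //; apply/imfsetP; exists a.
move=> a b _ _ [e1 e2]; apply/eqP/negPn/negP => ab.
have crossB v w : cross d v = cross d w -> cross d (v - w) = 0.
  by rewrite /cross !mxE => e; lra.
have [c1 h1] := cross_eq0 d0 (crossB _ _ e1).
have [c2] := cross_eq0 d0 (crossB _ _ e2); rewrite -mulmxBl => h2.
have c10 : c1 != 0.
  by apply: contraNneq ab => c0; rewrite -subr_eq0 h1 c0 scale0r.
have /negP := noeig (c2 / c1); apply; apply/eigenvalueP; exists (a - b).
  by rewrite h2 h1 scalerA divfK.
by rewrite subr_eq0.
Qed.

Lemma card_lin_image L A : L \in unitmx -> #|` lin_image L A| = #|` A|.
Proof. by move=> Lu; rewrite card_imfset//; exact: can_inj (mulmxK Lu). Qed.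

Lemma plane_bound L A r t : r = (4 ^ 5)%N -> L \in unitmx -> (forall a : R, ~~ eigenvalue L a) ->
  (#|` A [+] lin_image L A| <= 4 * #|` A|)%N -> (r ^ t < #|` A|)%N ->
  exists2 n, (4 * #|` A| <= #|` A [+] lin_image L A| + 14 * n)%N &
    (n * 2 ^ t.+1 <= 4 ^ 3 * #|` A| * t.+1.*2.+1 ^ r)%N.
Proof.
move=> -> Lu noeig T4 tN; set B := lin_image L A in T4 *.
have BA : #|` B| = #|` A| by exact: card_lin_image.
have tf (v : plane) k : v *+ k = 0 -> v = 0 \/ k = 0%N.
  rewrite -scaler_nat => /eqP; rewrite scaler_eq0 pnatr_eq0.
  by case/orP => /eqP; [right|left].
have [|d d0 hd] := rich_direction (t := t) tf (esym BA) T4; first by rewrite BA.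
exists (lines (cross d) B).
  apply: (few_lines_bound (crossD d) (dotD d)) => //; last exact: leq_card_lines_mul.
    by move=> v w; exact: cross_dot_inj.
  by rewrite -cardfs_gt0 (leq_ltn_trans _ tN).
rewrite -BA; apply: hd => v j.
by rewrite /cross !mxE !mulmxnE -[d 0 1 *+ j]mulr_natr -[d 0 0 *+ j]mulr_natr; ring.
Qed.

End Plane.

(** * Choice of the scale *)

Lemma log_scale r N : (1 < r)%N -> (1 < N)%N ->
  exists u, (r ^ u < N)%N /\ (N <= r ^ u.+1)%N.
Proof.
move=> r1 N1; have ex : exists u, (N <= r ^ u.+1)%N.
  by exists N; rewrite ltnW// (ltn_trans (ltnSn N))// ltn_expl.
case: (ex_minnP ex) => u Nu umin; exists u; split => //.
case: u Nu umin => [//|u] _ umin; rewrite ltnNge; apply/negP => /umin.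
by rewrite ltnn.
Qed.

(** The scale [u] is chosen with [N] between [2^(20u)] and [2^(20(u+1))]; with
    [t = 2u] the number [n] of lines is [O(N / 2^u)], which is
    [O(N^(1 - 1/20))]. *)
Theorem theorem1p3 (R : realType) :
  exists delta : R, 0 < delta /\
  exists K : R, 0 < K /\
  forall (A : {fset 'rV[R]_2}) (L : 'M[R]_2),
    L \in unitmx ->
    (forall a : R, ~~ eigenvalue L a) ->
    4 * (#|` A|)%:R - K * (#|` A|)%:R `^ (1 - delta)
      <= (#|` sumset A (lin_image L A)|)%:R.
Proof.
(* [r] is a variable, so that powers with exponent [4^5] are never computed. *)
have [r rE] : exists r, r = (4 ^ 5)%N by exists (4 ^ 5)%N.
have [C hC] := succn_expn_bound r.
pose delta : R := 20%:R^-1.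
have delta0 : 0 < delta by rewrite invr_gt0.
(* The summand 4 covers the one-point sets. *)
exists delta; split => //; exists (4 + 14 * (64 * C%:R)); split.
  by apply: ltr_pwDl; [rewrite ltr0n|rewrite !mulr_ge0 ?ler0n].
move=> A L Lu noeig.
have [T4|/ltnW T4] := leqP #|` A [+] lin_image L A| (4 * #|` A|); last first.
  apply: le_trans (_ : 4 * #|` A|%:R <= _); last by rewrite -natrM ler_nat.
  by rewrite gerBl mulr_ge0 ?powR_ge0// addr_ge0// mulr_ge0.
set T := #|` _ [+] _| in T4 *.
have [N1|N1] := leqP #|` A| 1.
  apply: (@le_trans _ _ 0) => //.
  case: #|` A| N1 => [|[|//]] _.
    by rewrite mulr0 sub0r oppr_le0 mulr_ge0 ?powR_ge0// addr_ge0// mulr_ge0.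
  by rewrite powR1 !mulr1 opprD addrA subrr sub0r oppr_le0 mulr_ge0.
have r10 : r = (2 ^ 10)%N by rewrite rE (_ : 4 = 2 ^ 2)%N// -expnM.
have r1 : (1 < r * r)%N.
  by rewrite r10 -expnD -[X in (X < _)%N](expn0 2) ltn_exp2l.
(* [(r * r)^u] is [r^(2u)]: the scale is [t = 2u].  The even exponent
   leaves room for the polynomial factor: half of the gain [2^(2u)] absorbs it. *)
have [u [uN Nu]] := log_scale r1 N1.
have [|n hn1 hn2] := plane_bound (t := u.*2) rE Lu noeig T4.
  by rewrite -addnn expnD -expnMn.
(* The constant 32 is [4^3 / 2]. *)
have {}hn2 : (n * 2 ^ u <= 32 * C * #|` A|)%N.
  have := hC u; have -> : (4 * u + 3 = u.*2.+1.*2.+1)%N by lia.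
  move: hn2; rewrite expnS -[(u.*2)%N]addnn expnD -addnn.
  have P0 : (0 < 2 ^ u)%N by rewrite expn_gt0.
  have -> : (u + u = u.*2)%N by lia.
  set P := (2 ^ u)%N in P0 *; set E := (_ ^ r)%N => hE EC.
  rewrite -(leq_pmul2r (_ : 0 < 2 * P)%N) ?muln_gt0//.
  have -> : (n * P * (2 * P) = n * (2 * (P * P)))%N by lia.
  apply: (leq_trans hE); apply: leq_trans (leq_mul (leqnn _) EC) _.
  by rewrite (_ : 4 ^ 3 = 64)%N//; lia.
have {}Nu : (#|` A| <= (2 * 2 ^ u) ^ 20)%N.
  apply: (leq_trans Nu); rewrite -expnS r10 -expnD -!expnM.
  by rewrite leq_exp2l// mulnC.
set N := #|` A| in N1 Nu hn1 hn2 T4 *.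
have Np : (0 < N%:R :> R) by rewrite ltr0n ltnW.
have Npow : N%:R `^ (1 - delta) * N%:R `^ delta = N%:R :> R.
  by rewrite -powRD ?subrK ?powRr1 ?gt_eqF ?implybT// ltW.
have Ndelta : N%:R `^ delta <= 2 * 2 ^+ u :> R.
  have step : N%:R `^ delta <= ((2 * 2 ^+ u) ^+ 20) `^ delta :> R.
    apply: (ge0_ler_powR (ltW delta0)).
    - exact: ltW.
    - by rewrite nnegrE exprn_ge0// mulr_ge0// exprn_ge0.
    have -> : (2 * 2 ^+ u) ^+ 20 = ((2 * 2 ^ u) ^ 20)%:R :> R.
      by rewrite natrX natrM natrX.
    by rewrite ler_nat.
  apply: (le_trans step); rewrite -powR_mulrn ?mulr_ge0 ?exprn_ge0//.
  by rewrite -powRrM divff// powRr1 ?mulr_ge0 ?exprn_ge0.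
have hn : n%:R <= 64 * C%:R * N%:R `^ (1 - delta) :> R.
  have dp : 0 < N%:R `^ delta :> R by rewrite powR_gt0.
  rewrite -(ler_pM2r dp) -[leRHS]mulrA Npow.
  apply: (le_trans (ler_wpM2l _ Ndelta)) => //.
  move: hn2; rewrite -(ler_nat R) !natrM natrX; lra.
have : 4 * N%:R <= T%:R + 14 * n%:R :> R.
  by rewrite -!natrM -natrD ler_nat.
have : 0 <= N%:R `^ (1 - delta) :> R by exact: powR_ge0.
by set X := N%:R `^ (1 - delta) in hn *; lra.
Qed.
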